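(* For $M>0$, let $q_M\in(0,1)$ be the value such that $E(1\|q_M)=\ln(1/q_M)-(1-q_M)=M$, and let $p_M=\min(2,p')$, where $p'>1$ is the number such that $E(p'\|1)=p'\ln p'-(p'-1)=M$. Then there exists a constant $C>0$, independent of $M$, such that for every $M>0$ $$\frac{E(p_M\|q_M)}{M}<C.$$
   Context: The divergence function $E$ is defined by $E(p\|q)=p\ln(p/q)-(p-q)$; here it is evaluated only at $p,q>0$. *)

(* Defs.v *)
From Stdlib Require Import Reals.
Open Scope R_scope.

(* Meaningful for p, q > 0, the only arguments at which it is used; Stdlib's ln is
   total, with ln x = 0 for x <= 0. *)
Definition E (p q : R) : R := p * ln (p / q) - (p - q).

(* Main.v *)
(** With [p = min 2 p'], one has [E p q = E p 1 + p * E 1 q + (p - 1) * (1 - q)].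
    The first term is at most [M] by monotonicity of [E _ 1] on [1, oo), the
    second at most [2 * M], and both [(1 - q)^2] and [(p - 1)^2] are [O(M)]
    because [E 1 q] is at least quadratic at [q = 1] and
    [E p 1 = p * E 1 (1 / p)]. *)
Require Import Defs.
From Stdlib Require Import Reals Lra.
Open Scope R_scope.

Lemma ln_le_sub1 (x : R) : 0 < x -> ln x <= x - 1.
Proof.
  intros Hx.
  pose proof (exp_ineq1_le (ln x)) as H.
  rewrite exp_ln in H by exact Hx. lra.
Qed.

Lemma ln_div (x y : R) : 0 < x -> 0 < y -> ln (x / y) = ln x - ln y.
Proof.
  intros Hx Hy; unfold Rdiv.
  rewrite ln_mult, ln_Rinv; [ring | assumption.. | now apply Rinv_0_lt_compat].
Qed.

Lemma E_lnB (p q : R) : 0 < p -> 0 < q -> E p q = p * (ln p - ln q) - (p - q).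
Proof. intros Hp Hq; unfold E; now rewrite ln_div. Qed.

Lemma E_nonneg (p q : R) : 0 < p -> 0 < q -> 0 <= E p q.
Proof.
  intros Hp Hq.
  assert (Hqp : 0 < q / p) by now apply Rdiv_lt_0_compat.
  pose proof (ln_le_sub1 _ Hqp) as H.
  rewrite ln_div in H by assumption.
  apply (Rmult_le_compat_l p) in H; [|lra].
  replace (p * (q / p - 1)) with (q - p) in H by (field; lra).
  rewrite E_lnB by assumption. lra.
Qed.

(** The difference [E p' 1 - E p 1] equals [E p' p + (p' - p) * ln p], and both terms are
    nonnegative. *)
Lemma E_incr_l (p p' : R) : 1 <= p -> p <= p' -> E p 1 <= E p' 1.
Proof.
  intros Hp Hpp'.
  assert (Hln : 0 <= ln p) by 
    (rewrite <- ln_1; destruct Hp as [Hp | <-];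
     [left; apply ln_increasing; lra | apply Rle_refl]).
  pose proof (E_nonneg p' p ltac:(lra) ltac:(lra)) as H.
  pose proof (Rmult_le_pos (p' - p) (ln p) ltac:(lra) Hln).
  rewrite !E_lnB, ?ln_1 in * by lra. lra.
Qed.

(* Applying [ln s <= s - 1] at [s = sqrt q] gives [(1 - s)^2 <= E 1 q], and
   [1 - q = (1 - s) * (1 + s) <= 2 * (1 - s)]. *)
Lemma E_1_quadratic (q : R) : 0 < q <= 1 -> (1 - q) ^ 2 <= 4 * E 1 q.
Proof.
  intros [Hq Hq1].
  rewrite E_lnB, ln_1 by lra.
  assert (Hs : 0 < sqrt q) by now apply sqrt_lt_R0.
  assert (Hss : sqrt q * sqrt q = q) by (apply sqrt_sqrt; lra).
  assert (Hs1 : sqrt q <= 1) by (rewrite <- sqrt_1; now apply sqrt_le_1_alt).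
  pose proof (ln_le_sub1 _ Hs) as Hl.
  set (s := sqrt q) in *; clearbody s; subst q.
  rewrite ln_mult by assumption.
  assert ((1 - s) ^ 2 * (1 + s) ^ 2 <= (1 - s) ^ 2 * 4)
    by (apply Rmult_le_compat_l; [apply pow2_ge_0 | nra]).
  nra.
Qed.

Lemma E_inv (p : R) : 0 < p -> E p 1 = p * E 1 (/ p).
Proof.
  intros Hp.
  rewrite !E_lnB, ln_1, ln_Rinv; try lra; [field; lra | now apply Rinv_0_lt_compat].
Qed.

(** This is [E_1_quadratic] at [/ p], multiplied by [p ^ 2]. *)
Lemma E_quadratic_1 (p : R) : 1 <= p -> (p - 1) ^ 2 <= 4 * p * E p 1.
Proof.
  intros Hp.
  assert (Hi : 0 < / p <= 1).
  { split; [apply Rinv_0_lt_compat; lra|].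
    rewrite <- Rinv_1; apply Rinv_le_contravar; lra. }
  pose proof (E_1_quadratic _ Hi) as H.
  apply (Rmult_le_compat_l (p ^ 2)) in H; [|apply pow2_ge_0].
  replace (p ^ 2 * (1 - / p) ^ 2) with ((p - 1) ^ 2) in H by (field; lra).
  rewrite E_inv by lra. lra.
Qed.

(** The three-point identity of Bregman divergences has cross term [- (p - 1) * ln q]; here [- ln q]
    is rewritten as [E 1 q + (1 - q)]. *)
Lemma E_split (p q : R) : 0 < p -> 0 < q ->
  E p q = E p 1 + p * E 1 q + (p - 1) * (1 - q).
Proof. intros Hp Hq; rewrite !E_lnB, ln_1 by lra; ring. Qed.

Theorem theorem1 :
  exists C : R, 0 < C /\
    forall M : R, 0 < M ->
    forall qM p' : R,
      0 < qM < 1 -> E 1 qM = M ->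
      1 < p' -> E p' 1 = M ->
      E (Rmin 2 p') qM / M < C.
Proof.
  (* The three terms of [E_split] are at most [M], [2 * M] and [6 * M]; any constant above 9
     works. *)
  exists 10; split; [lra|].
  intros M HM q p' Hq HqM Hp' Hp'M.
  assert (Hp : 1 <= Rmin 2 p') by (apply Rmin_glb; lra).
  pose proof (Rmin_l 2 p') as Hp2.
  pose proof (E_incr_l _ _ Hp (Rmin_r 2 p')) as HpM.
  set (p := Rmin 2 p') in *; clearbody p.
  rewrite Hp'M in HpM.
  pose proof (E_1_quadratic q ltac:(lra)) as Qq.
  pose proof (E_quadratic_1 p Hp) as Qp.
  assert (HpE : p * E p 1 <= 2 * M)
    by (apply Rmult_le_compat; try lra; apply E_nonneg; lra).
  assert (HpMM : p * M <= 2 * M) by (apply Rmult_le_compat_r; lra).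
  apply (Rmult_lt_reg_r M); [exact HM|].
  unfold Rdiv; rewrite Rmult_assoc, Rinv_l, Rmult_1_r by lra.
  rewrite E_split, HqM by lra.
  rewrite HqM in Qq.
  (* AM-GM: the cross term is at most half of [(p - 1) ^ 2 + (1 - q) ^ 2], hence at most
     [(8 * M + 4 * M) / 2]. *)
  pose proof (pow2_ge_0 ((p - 1) - (1 - q))).
  nra.
Qed.
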